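(* Let $n\geq 3$ and $d\geq 3$ be integers, and let $f=\sum_{|\alpha|=d}\varepsilon_\alpha x^\alpha$ be the random sign form of degree $d$ in $x_0,\ldots,x_n$. Then $$\mathbf P(f\text{ is not absolutely irreducible})\leq\frac{n(n+1)d^{n-1}}{2^{\lfloor (d-1)/3\rfloor+1}}.$$
   Context: For a tuple $\alpha=(\alpha_0,\ldots,\alpha_n)$ of nonnegative integers put $|\alpha|=\alpha_0+\cdots+\alpha_n$ and $x^\alpha=x_0^{\alpha_0}\cdots x_n^{\alpha_n}$. The coefficients $\varepsilon_\alpha$, one for each $\alpha$ with $|\alpha|=d$, are independent random variables, each equal to $1$ or $-1$ with probability $1/2$; $\mathbf P$ denotes the resulting probability. A polynomial is absolutely irreducible if it is irreducible over an algebraic closure of its coefficient field; for the integral forms $f$ here this is equivalent to irreducibility over $\mathbb C$. *)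

(* Defs.v *)
From HB Require Import structures.
From mathcomp Require Import all_boot all_order all_algebra all_field.
(* The notations of mpoly and of mathcomp-analysis cannot be loaded together;
   the few that are used here are declared again below. *)
From mathcomp Require Import -(notations) mpoly.
From mathcomp Require Import all_classical all_reals all_analysis.

Set Implicit Arguments.
Unset Strict Implicit.
Unset Printing Implicit Defensive.

Import Order.TTheory GRing.Theory Num.Theory.

Local Open Scope classical_set_scope.
Local Open Scope ring_scope.

Notation "{ 'mpoly' T [ n ] }" := (mpoly.mpoly n T)
  (at level 0, T at level 2, format "{ 'mpoly'  T [ n ] }") : type_scope.

(* Integer-valued random variables are taken with respect to the discrete
   sigma-algebra, as the library does for [nat]. *)
HB.instance Definition _ := isPointed.Build int 0.
HB.instance Definition _ := @isMeasurable.Build default_measure_display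
  int discrete_measurable discrete_measurable0
  discrete_measurableC discrete_measurableU.

Definition independent_RV (d d' : measure_display) (T : measurableType d)
    (T' : measurableType d') (R : realType) (P : probability T R)
    (I : finType) (X : I -> {RV P >-> T'}) : Prop :=
  forall (J : {set I}) (B : I -> set T'),
    (forall i, i \in J -> measurable (B i)) ->
    P [set w | forall i, i \in J -> B i (X i w)] =
      (\prod_(i in J) P (X i @^-1` B i))%E.

Definition rademacher (d : measure_display) (T : measurableType d)
    (R : realType) (P : probability T R) (X : {RV P >-> int}) : Prop :=
  P (X @^-1` [set 1]) = (2^-1)%:E /\ P (X @^-1` [set -1]) = (2^-1)%:E.

Arguments independent_RV {d d' T T' R} P {I} X.
Arguments rademacher {d T R} P X.

Definition irreducible_elt (A : unitRingType) (p : A) : Prop :=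
  [/\ p != 0, p \isn't a GRing.unit &
      forall q r : A, p = q * r -> q \is a GRing.unit \/ r \is a GRing.unit].

(* [algC] is the library's algebraic closure of [rat]. *)
Definition absolutely_irreducible (m : nat) (p : {mpoly rat[m]}) : Prop :=
  irreducible_elt (map_mpoly (ratr : rat -> algC) p).

(* Exponent tuples (a_0, ..., a_n) with |a| = d; the bound d.+1 only serves to
   obtain a finite type. *)
Definition exponent (n d : nat) : finType :=
  {a : mpoly.bmultinom n.+1 d.+1 | mdeg a == d}.

Definition form_of_coeffs (n d : nat) (c : exponent n d -> int) :
    {mpoly rat[n.+1]} :=
  \sum_(a : exponent n d) (c a)%:~R *: mpolyX rat (val a).

(* Main.v *)
(** If [f = g h], the top homogeneous parts of [g] and [h] give a
    factorization [f = G H] into forms of degrees [a <= b], [a + b = d].  Setting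
    [x_i = 0] for [i >= 3] in [f] and in its derivative along [x_3] yields forms
    in [x_0, x_1, x_2] with [f_0 = G_0 H_0] and [f_1 = G_1 H_0 + G_0 H_1], where
    [f_0] and [f_1] have disjoint, hence independent, sets of random coefficients.
    Given [f_0] and the pair [(G_0, H_0)], the form [f_1] lies in a space whose
    codimension in the forms of degree [d - 1] is at least
    [C(d + 1, 2) - C(a + 1, 2) - C(b + 1, 2) = a b], and a subspace of codimension
    [c] contains at most a fraction [2 ^ - c] of the sign vectors.  Up to scalars,
    [f_0] has at most [(d + 1) ^ a] divisors of degree [a], because restriction to
    a generic line separates finitely many of them and a univariate polynomial
    is determined, up to a scalar, by its roots.  Hence [f] is reducible with
    probability at most the sum over [a <= d / 2] of [(d + 1) ^ a / 2 ^ (a b)],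
    which is below the bound for [d >= 5]; for [d <= 4] the bound exceeds 1. *)
Require Import Defs.
From HB Require Import structures.
From mathcomp Require Import all_boot all_order all_algebra all_field.
From mathcomp Require Import zify lra.
From mathcomp Require Import -(notations) mpoly.
From mathcomp Require Import all_classical all_reals all_analysis.

Set Implicit Arguments.
Unset Strict Implicit.
Unset Printing Implicit Defensive.

Import Order.TTheory GRing.Theory Num.Theory.
Import VectorInternalTheory.

Local Open Scope classical_set_scope.
Local Open Scope ring_scope.

Local Notation homog d := (ishomog1 d mdeg).


Definition bsign (R : pzRingType) (b : bool) : R := if b then 1 else -1.

Lemma bsign_inj (R : numDomainType) : injective (@bsign R).
Proof.
have N1 : (-1 : R) < 1 by rewrite (lt_trans _ ltr01) ?oppr_lt0 ?ltr01.
by case=> [] [] //= /eqP; rewrite ?(gt_eqF N1) ?(lt_eqF N1).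
Qed.

(** * Sign vectors in a subspace *)

(* A vector of a space of dimension [k] is determined by its values at at most
   [k] well-chosen coordinates. *)
Lemma card_sign_vectors_le (K : numFieldType) (V : vectType K) (E : finType)
    (E1 : {set E}) (c : E -> {linear V -> K^o}) (t : {ffun E -> bool})
    (S : {set {ffun E -> bool}}) :
  (forall s, s \in S -> forall j, j \notin E1 -> s j = t j) ->
  (forall s, s \in S -> exists v, forall j, j \in E1 -> c j v = bsign K (s j)) ->
  (#|S| <= 2 ^ dim V)%N.
Proof.
move=> agree lin.
pose A := \matrix_(i < dim V, k < #|E1|) (c (enum_val k) (r2v (delta_mx 0 i)) : K).
have rowA v k : (v2r v *m A) 0 k = c (enum_val k) v.
  rewrite mxE -[in RHS](v2rK v) [in RHS](row_sum_delta (v2r v)) !linear_sum /=.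
  by apply: eq_bigr => i _; rewrite !linearZ mxE.
(* A maximal independent set of columns of [A] spans the others, so the values at those coordinates,
   at most [dim V] many, determine all values on [E1]. *)
have [C AE] : exists C, A^T = C *m rowsub (maxrankfun A^T) A^T.
  by apply/submxP; rewrite eq_maxrowsub.
pose f (i : 'I_(\rank A^T)) := enum_val (maxrankfun A^T i).
pose code (s : {ffun E -> bool}) := [ffun i => s (f i)].
have code_inj : {in S &, injective code}.
  move=> s s' sS s'S /ffunP eqc; apply/ffunP=> j.
  have [jE1|jE1] := boolP (j \in E1); last by rewrite !(agree _ _ _ jE1).
  have [v vP] := lin _ sS; have [v' v'P] := lin _ s'S.
  apply: (@bsign_inj K); rewrite -vP // -v'P //.
  rewrite -(enum_rankK_in jE1 jE1) -!rowA.
  suff -> : v2r v *m A = v2r v' *m A by [].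
  have AE' : A = (rowsub (maxrankfun A^T) A^T)^T *m C^T.
    by rewrite -trmx_mul -AE trmxK.
  rewrite AE' !mulmxA; congr (_ *m _); apply/rowP => i.
  have key w : (v2r w *m (rowsub (maxrankfun A^T) A^T)^T) 0 i = c (f i) w.
    by rewrite -rowA !mxE; apply: eq_bigr => k _; rewrite !mxE.
  by rewrite !key vP ?v'P ?enum_valP //; move: (eqc i); rewrite !ffunE => ->.
rewrite -(card_in_imset code_inj); apply: leq_trans (max_card _) _.
by rewrite card_ffun card_bool card_ord leq_exp2l // (leq_trans (rank_leq_col _)).
Qed.

(** * Divisors of a form, up to scalars *)

Lemma digits_inj (N : nat) n (f g : nat -> nat) :
  (forall i, f i < N)%N -> (forall i, g i < N)%N ->
  (\sum_(i < n) f i * N ^ i = \sum_(i < n) g i * N ^ i)%N ->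
  forall i, (i < n)%N -> f i = g i.
Proof.
elim: n f g => // n IH f g fN gN.
have H (h : nat -> nat) : (\sum_(i < n.+1) h i * N ^ i =
    (\sum_(i < n) h i.+1 * N ^ i) * N + h 0)%N.
  rewrite big_ord_recl /= expn0 muln1 addnC big_distrl /=; congr addn.
  by apply: eq_bigr => i _; rewrite /bump /= add1n expnSr mulnA.
have N0 : (0 < N)%N by exact: leq_ltn_trans (fN 0).
rewrite !H => eqfg.
have e0 : f 0 = g 0.
  by have := congr1 (modn^~ N) eqfg; rewrite /= !modnMDl !modn_small.
case=> // i lt_in; apply: (IH (f \o S) (g \o S)) => //=.
  by move/eqP: eqfg; rewrite e0 eqn_add2r eqn_pmul2r // => /eqP.
Qed.

(** The integers below [size q] are distinct in characteristic zero and too many to be all roots of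
    [q]. *)
Lemma poly_neq0_nonroot (K : numDomainType) (q : {poly K}) :
  q != 0 -> exists x, q.[x] != 0.
Proof.
move=> q0; pose rs := [seq i%:R : K | i <- iota 0 (size q)].
have /allPn [x _ qx] : ~~ all (root q) rs.
  apply/negP => allr; have := max_poly_roots q0 allr.
  rewrite map_inj_uniq ?iota_uniq; last exact: (mulrIn (oner_neq0 K)).
  by rewrite size_map size_iota ltnn => /(_ isT).
by exists x.
Qed.

(* Kronecker substitution [x_i := x ^ (N ^ i)]. *)
Lemma mpoly_neq0_nonroot (K : numDomainType) n (p : {mpoly K[n]}) :
  p != 0 -> exists v, meval v p != 0.
Proof.
(* [N] exceeds the total degree, so exponents are digits in base [N] and distinct monomials get
   distinct powers of [x]. *)
move=> p0; pose N := mmeasure mdeg p.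
have small m : m \in msupp p -> forall i : 'I_n, (m i < N)%N.
  move=> /msize_mdeg_lt mN i; apply: leq_ltn_trans mN.
  by rewrite mdegE (bigD1 i) //= leq_addr.
pose e (m : multinom n) := (\sum_(i < n) m i * N ^ i)%N.
have e_inj : {in msupp p &, injective e}.
  move=> m m' mp m'p eqe; apply/mnmP => i.
  pose ex (m : multinom n) k := oapp m 0%N (insub k : option 'I_n).
  have exE (k : multinom n) (j : 'I_n) : ex k j = k j by rewrite /ex valK.
  have exN k : k \in msupp p -> forall j, (ex k j < N)%N.
    move=> kp j; rewrite /ex; case: insubP => [j' _ _|_] /=; first exact: small.
    exact: leq_ltn_trans (small _ kp i).
  rewrite -!exE; apply: (@digits_inj N n) => //; try exact: exN.
  by under eq_bigr do rewrite exE; under [RHS]eq_bigr do rewrite exE.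
pose q : {poly K} := \sum_(m <- msupp p) mcoeff m p *: 'X^(e m).
have [m mp] : exists m, m \in msupp p.
  by exists (mlead p); rewrite mlead_supp.
have q0 : q != 0.
  apply/eqP => q0; have := mp; rewrite mcoeff_msupp => /eqP; apply.
  rewrite -(coef0 K (e m)) -q0 coef_sum (bigD1_seq m) ?msupp_uniq //=.
  rewrite coefZ coefXn eqxx mulr1 big1_seq ?addr0 // => m' /andP [m'm m'p].
  by rewrite coefZ coefXn (inj_in_eq e_inj) // eq_sym (negbTE m'm) mulr0.
have [x qx] := poly_neq0_nonroot q0.
exists (fun i : 'I_n => x ^+ (N ^ i)); rewrite mevalE.
suff <- : q.[x] = \sum_(m <- msupp p) mcoeff m p * \prod_(i < n) (x ^+ (N ^ i)) ^+ m i by [].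
rewrite horner_sum; apply: eq_bigr => k _; rewrite hornerZ hornerXn; congr (_ * _).
by rewrite /e expr_sum; apply: eq_bigr => i _; rewrite -exprM mulnC.
Qed.

(** A divisor of [u] is determined up to a scalar by its at most [a] roots, each among the at most
    [d] roots of [u]. Cross-multiplied values express proportionality without naming the scalar. *)
Lemma split_divisor_code (K : closedFieldType) (u : {poly K}) (d a : nat) :
  u != 0 -> (size u <= d.+1)%N ->
  exists code : {poly K} -> {ffun 'I_a -> 'I_d.+1},
    forall g h, g %| u -> h %| u -> (size g <= a.+1)%N -> (size h <= a.+1)%N ->
      code g = code h -> forall x y, g.[x] * h.[y] = g.[y] * h.[x].
Proof.
move=> u0 su; pose rts (g : {poly K}) := sval (closed_field_poly_normal g).
have rtsE g : g = lead_coef g *: \prod_(z <- rts g) ('X - z%:P).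
  exact: (svalP (closed_field_poly_normal g)).
have size_rts g : g != 0 -> (size (rts g)).+1 = size g.
  by move=> g0; rewrite [in RHS](rtsE g) size_scale ?lead_coef_eq0 // size_prod_XsubC.
have mem_rts g z : g != 0 -> (z \in rts g) = root g z.
  by move=> g0; rewrite [in RHS](rtsE g) rootZ ?lead_coef_eq0 // root_prod_XsubC.
have dvd_neq0 g : g %| u -> g != 0.
  by apply: contraTneq => ->; rewrite dvd0p.
have sub_rts g z : g %| u -> z \in rts g -> z \in rts u.
  by move=> gu; rewrite !mem_rts ?dvd_neq0 // => /(root_dvdp gu).
pose ixs g := [seq index z (rts u) | z <- rts g].
have ixsK g : g %| u -> [seq nth 0 (rts u) i | i <- ixs g] = rts g.
  move=> gu; rewrite -map_comp -[RHS]map_id; apply/eq_in_map => z zg /=.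
  by rewrite nth_index // (sub_rts g).
(* Roots are coded by their index among the roots of [u], padded with [d]. *)
pose pad g := ixs g ++ nseq (a - size (rts g)) d.
have padK g : g %| u -> [seq i <- pad g | (i < d)%N] = ixs g.
  move=> gu; rewrite filter_cat filter_nseq ltnn cats0.
  apply/all_filterP/allP => _ /mapP [z zg ->].
  by rewrite (leq_trans (_ : _ < size (rts u))%N) ?index_mem ?(sub_rts g) // -ltnS size_rts.
exists (fun g => [ffun k : 'I_a => inord (nth d (pad g) k)]).
move=> g h gu hu sg sh /ffunP eqc x y.
have size_pad f : f %| u -> (size f <= a.+1)%N -> size (pad f) = a.
  move=> fu; rewrite -size_rts ?dvd_neq0 // ltnS => le.
  by rewrite size_cat size_map size_nseq subnKC.
have le_pad f k : f %| u -> (nth d (pad f) k <= d)%N.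
  move=> fu; have [kf|/(nth_default _) -> //] := ltnP k (size (pad f)).
  have := mem_nth d kf; rewrite mem_cat => /orP [|/nseqP [-> //]].
  by rewrite -(padK f) // mem_filter => /andP [/ltnW].
have pad_eq : pad g = pad h.
  apply: (@eq_from_nth _ d) => [|k]; rewrite !size_pad // => ka.
  have := congr1 val (eqc (Ordinal ka)); rewrite !ffunE /=.
  by rewrite !inordK ?ltnS ?le_pad.
have rts_eq : rts g = rts h by rewrite -ixsK // -padK // pad_eq padK // ixsK.
by rewrite (rtsE g) (rtsE h) rts_eq !hornerZ mulrACA [in RHS]mulrACA [X in _ * X]mulrC.
Qed.

(** * Restriction of polynomials to a line *)

Section Line.
Variables (K : comNzRingType) (n : nat) (v w : 'I_n -> K).

Definition restrict_line : {mpoly K[n]} -> {poly K} :=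
  mmap (@polyC K) (fun i => (v i)%:P + (w i - v i) *: 'X).

Lemma restrict_lineM p q : restrict_line (p * q) = restrict_line p * restrict_line q.
Proof. by rewrite /restrict_line rmorphM. Qed.

Lemma horner_restrict_line p x :
  (restrict_line p).[x] = meval (fun i => v i + (w i - v i) * x) p.
Proof.
rewrite /restrict_line /meval /mmap horner_sum; apply: eq_bigr => m _.
rewrite hornerM hornerC; congr (_ * _); rewrite /mmap1 horner_prod.
by apply: eq_bigr => i _; rewrite horner_exp hornerD hornerC hornerZ hornerX.
Qed.

Lemma restrict_line0 p : (restrict_line p).[0] = meval v p.
Proof. by rewrite horner_restrict_line; apply: meval_eq => i; rewrite mulr0 addr0. Qed.

Lemma restrict_line1 p : (restrict_line p).[1] = meval w p.
Proof. by rewrite horner_restrict_line; apply: meval_eq => i; rewrite mulr1 addrC subrK. Qed.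

Lemma size_restrict_line p : (size (restrict_line p) <= mmeasure mdeg p)%N.
Proof.
apply: leq_trans (size_sum _ _ _) _.
apply/bigmax_leqP_seq => m mp _; apply: leq_trans (msize_mdeg_lt mp).
rewrite mul_polyC (leq_trans (size_scale_leq _ _)) // /mmap1 mdegE.
apply: (big_ind2 (fun (q : {poly K}) k => size q <= k.+1)%N).
- by rewrite size_poly1.
- move=> q k q' k' sq sq'; apply: leq_trans (size_polyMleq _ _) _.
  by have := leq_add sq sq'; rewrite addSn addnS; case: (size q + size q')%N.
move=> i _; apply: leq_trans (size_poly_exp_leq _ _) _; rewrite ltnS.
rewrite -[leqRHS]mul1n leq_mul2r -subn1 leq_subLR; apply/orP; right.
rewrite (leq_trans (size_polyD _ _)) // geq_max size_polyC (leq_trans (leq_b1 _)) //=.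
by rewrite (leq_trans (size_scale_leq _ _)) // size_polyX.
Qed.
End Line.

Lemma mpoly_common_nonroot (K : numDomainType) n (I : finType)
    (G : I -> {mpoly K[n]}) :
  exists v, forall i, G i != 0 -> meval v (G i) != 0.
Proof.
have [|v] := @mpoly_neq0_nonroot K n (\prod_(i | G i != 0) G i).
  by apply/prodf_neq0.
rewrite rmorph_prod /= => /prodf_neq0 h; exists v => i; exact: h.
Qed.

Lemma mpoly_divisor_code (K : numClosedFieldType) n (F : {mpoly K[n]}) (d a : nat)
    (I : finType) (G : I -> {mpoly K[n]}) :
  F != 0 -> (mmeasure mdeg F <= d.+1)%N ->
  (forall i, exists H, F = G i * H) ->
  (forall i, mmeasure mdeg (G i) <= a.+1)%N ->
  exists code : I -> {ffun 'I_a -> 'I_d.+1},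
    forall i j, code i = code j -> exists2 c, c != 0 & G j = c *: G i.
Proof.
move=> F0 sF divF sG.
(* The line through [v] and [w] is chosen so that non-proportional [G i], [G j]
   have different ratios of values at [v] and [w]. *)
have [v Fv] := mpoly_neq0_nonroot F0.
have Gv i : meval v (G i) != 0.
  by have [H FE] := divF i; move: Fv; rewrite FE rmorphM mulf_eq0 negb_or => /andP [].
pose D (ij : I * I) := meval v (G ij.1) *: G ij.2 - meval v (G ij.2) *: G ij.1.
have [w Dw] := mpoly_common_nonroot D.
pose res := restrict_line v w.
have [||code codeP] := @split_divisor_code K (res F) d a.
- apply: contraNneq Fv => rF0; by rewrite -(restrict_line0 v w) -/res rF0 horner0.
- exact: leq_trans (size_restrict_line _ _ _) sF.
exists (code \o res \o G) => i j /= eqc.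
have dvd k : res (G k) %| res F.
  by have [H ->] := divF k; rewrite /res restrict_lineM dvdp_mulr.
have sz k : (size (res (G k)) <= a.+1)%N := leq_trans (size_restrict_line _ _ _) (sG k).
have := codeP _ _ (dvd i) (dvd j) (sz i) (sz j) eqc 0 1.
rewrite !restrict_line0 !restrict_line1 => eqG.
exists (meval v (G j) / meval v (G i)); first by rewrite mulf_neq0 ?invr_eq0.
(* After multiplication by the value of [G i] at [v], the claim is [D (i, j) = 0]; otherwise [w]
   would be a nonroot of it, against the equal ratios. *)
apply: (can_inj (scalerK (Gv i))); rewrite scalerA mulrCA divff // mulr1.
apply/eqP; rewrite -subr_eq0; apply: contraTT isT => Dij.
have /negP [] := Dw (i, j) Dij.
by rewrite /D /= mevalB !mevalZ eqG mulrC subrr.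
Qed.

(** * Homogeneous factors and restriction of variables *)

Lemma dhomogP_coeff (R : nzRingType) n d (p : {mpoly R[n]}) :
  (forall k, mcoeff k p != 0 -> mdeg k = d) -> p \is homog d.
Proof. by move=> h; apply/dhomogP => k; rewrite mcoeff_msupp; exact: h. Qed.

Lemma dhomog_coeff (R : nzRingType) n d (p : {mpoly R[n]}) k :
  p \is homog d -> mcoeff k p != 0 -> mdeg k = d.
Proof. by move=> /dhomogP h; rewrite -mcoeff_msupp; exact: h. Qed.

Lemma msize_dhomog (R : nzRingType) n d (p : {mpoly R[n]}) :
  p \is homog d -> (mmeasure mdeg p <= d.+1)%N.
Proof. by move=> /dhomogP h; rewrite mmeasureE; apply/bigmax_leqP_seq => k /h ->. Qed.

Lemma dhomog_mderiv (R : nzRingType) n d (p : {mpoly R[n]}) i :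
  p \is homog d.+1 -> mderiv i p \is homog d.
Proof.
move=> hp; apply: dhomogP_coeff => k; rewrite mcoeff_deriv => nz.
have : mcoeff (mnm_add k (mnm1 i)) p != 0 by apply: contraNneq nz => ->; rewrite mul0rn.
by move=> /(dhomog_coeff hp) /eqP; rewrite mdegD mdeg1 addn1 eqSS => /eqP.
Qed.

(** Among the products of homogeneous components, only that of degrees [a] and [b] reaches degree
    [a + b]. *)
Lemma pihomog_top_mul (R : comNzRingType) n a b (g h : {mpoly R[n]}) :
  (mmeasure mdeg g <= a.+1)%N -> (mmeasure mdeg h <= b.+1)%N ->
  pihomog mdeg (a + b) (g * h) = pihomog mdeg a g * pihomog mdeg b h.
Proof.
move=> sg sh; rewrite {1}(pihomog_partitionE sg) {1}(pihomog_partitionE sh).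
have prodE (i j : nat) : pihomog mdeg i g * pihomog mdeg j h \is homog (i + j).
  by apply: dhomogM; apply: pihomogP.
rewrite mulr_suml linear_sum /= (bigD1 ord_max) //= mulr_sumr linear_sum /=.
rewrite (bigD1 ord_max) //= (pihomog_dE (prodE _ _)) big1 ?addr0 => [|j nj]; last first.
  by rewrite (pihomog_ne0 _ (prodE _ _)) // eqn_add2l.
rewrite big1 ?addr0 // => i ni; rewrite mulr_sumr linear_sum /= big1 // => j _.
rewrite (pihomog_ne0 _ (prodE _ _)) // ltn_eqF // -addSn leq_add //.
  by rewrite ltn_neqAle ni -ltnS ltn_ord.
by rewrite -ltnS.
Qed.

Lemma dhomog_factors (K : fieldType) n d (f g h : {mpoly K[n]}) :
  f \is homog d -> f != 0 -> f = g * h ->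
  g \isn't a GRing.unit -> h \isn't a GRing.unit ->
  exists a b G H, [/\ (a.+1 + b.+1 = d)%N, G \is homog a.+1, H \is homog b.+1
    & f = G * H].
Proof.
move=> hf f0 fE Ug Uh.
have [g0 h0] : g != 0 /\ h != 0.
  by apply/andP; rewrite -negb_or -mulf_eq0 -fE.
(* Over a field a nonzero nonunit is nonconstant, so both degrees are positive. *)
have big (p : {mpoly K[n]}) : p != 0 -> p \isn't a GRing.unit ->
    exists k, mmeasure mdeg p = k.+2.
  move=> p0 Up; case sp: (mmeasure mdeg p) => [|[|k]]; last by exists k.
    by move/eqP: sp; rewrite msize_poly_eq0 (negbTE p0).
  case/negP: Up; have /eqP/msize_poly1P [c c0 ->] := sp.
  by rewrite rmorph_unit // unitfE.
have [a sg] := big _ g0 Ug; have [b sh] := big _ h0 Uh.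
have dE : (a.+1 + b.+1 = d)%N.
  have : mmeasure mdeg f = (a.+1 + b.+1).+1 by rewrite fE msizeM // sg sh addnS.
  rewrite -mlead_deg // => -[<-].
  by apply: (dhomog_coeff hf); rewrite mleadc_eq0.
exists a, b, (pihomog mdeg a.+1 g), (pihomog mdeg b.+1 h).
split; rewrite ?dE ?pihomogP //.
by rewrite -pihomog_top_mul ?sg ?sh // -fE dE pihomog_dE.
Qed.

(** * Setting the last variables to zero *)

Section Restrict.
Variables (R : comNzRingType) (m r : nat).

Definition extend_mnm (k : multinom m) : multinom (m + r) :=
  Multinom [tuple (match fintype.split i with inl j => k j | inr _ => 0%N end) | i < m + r].

Definition restrict_vars : {mpoly R[m + r]} -> {mpoly R[m]} :=
  mmap (@mpolyC m R)
    (fun i => match fintype.split i with inl j => mpolyX R (mnm1 j) | inr _ => 0 end).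

HB.instance Definition _ := GRing.RMorphism.copy restrict_vars restrict_vars.

Lemma extend_mnm_l k j : extend_mnm k (lshift r j) = k j.
Proof. by rewrite mnmE (unsplitK (inl _ j)). Qed.

Lemma extend_mnm_r k j : extend_mnm k (rshift m j) = 0%N.
Proof. by rewrite mnmE (unsplitK (inr _ j)). Qed.

Lemma extend_mnm_inj : injective extend_mnm.
Proof. by move=> k l eqkl; apply/mnmP => j; rewrite -!extend_mnm_l eqkl. Qed.

Lemma mdeg_extend_mnm k : mdeg (extend_mnm k) = mdeg k.
Proof.
rewrite !mdegE big_split_ord /= [X in (_ + X)%N]big1 => [|i _]; last exact: extend_mnm_r.
by rewrite addn0; apply: eq_bigr => i _; rewrite extend_mnm_l.
Qed.

Lemma mcoeff_restrict_vars p k : mcoeff k (restrict_vars p) = mcoeff (extend_mnm k) p.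
Proof.
rewrite [in RHS](mpolyE p) !raddf_sum /=; apply: eq_bigr => M _.
rewrite mcoeffCM mcoeffZ mcoeffX; congr (_ * _).
rewrite /mmap1 big_split_ord /=.
under eq_bigr => j _ do rewrite (unsplitK (inl _ j)).
under [X in _ * X]eq_bigr => j _ do rewrite (unsplitK (inr _ j)) expr0n.
have [/forallP Mr|] := boolP [forall j : 'I_r, M (rshift m j) == 0%N]; last first.
  rewrite negb_forall => /existsP [j Mj].
  rewrite [X in _ * X](bigD1 j) //= (negbTE Mj) mul0r mulr0 mcoeff0.
  by case: eqP => // ME; rewrite ME extend_mnm_r in Mj.
rewrite [X in _ * X]big1 ?mulr1 => [|j _]; last by rewrite Mr.
have -> : \prod_(j < m) mpolyX R (mnm1 j) ^+ M (lshift r j)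
   = mpolyX R (Multinom [tuple M (lshift r j) | j < m]).
  by rewrite mpolyXE_id; apply: eq_bigr => j _; rewrite mnmE.
rewrite mcoeffX; congr ((nat_of_bool _)%:R); apply/eqP/eqP => [<-|->].
  apply/mnmP => i; case: (splitP i) => j ij.
    by have -> : i = lshift r j; [exact: val_inj | rewrite extend_mnm_l mnmE].
  by have -> : i = rshift m j; [exact: val_inj | rewrite extend_mnm_r; apply/eqP].
by apply/mnmP => j; rewrite mnmE extend_mnm_l.
Qed.

Lemma dhomog_restrict_vars d p :
  p \is homog d -> restrict_vars p \is homog d.
Proof.
move=> hp; apply: dhomogP_coeff => k.
by rewrite mcoeff_restrict_vars => /(dhomog_coeff hp); rewrite mdeg_extend_mnm.
Qed.
End Restrict.

(** * Counting reducible sign forms *)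

Lemma leq_card_fibers (T C : finType) (S : {set T}) (code : T -> C) (M B : nat) :
  (forall k, #|[set s in S | code s == k]| * M <= B)%N -> (#|S| * M <= #|C| * B)%N.
Proof.
move=> fib; rewrite -sum1_card (partition_big code predT) //= -sum_nat_const big_distrl /=.
by apply: leq_sum => k _; apply: leq_trans (fib k); rewrite -sum1dep_card.
Qed.

(** Conditioning on the signs outside [E1], by double counting the pairs [(s, t)] that agree there,
    with [s] in [S]: each [s] has [2 ^ #|E1|] partners and each [t] at most [B]. *)
Lemma leq_card_agree (E : finType) (E1 : {set E}) (S : {set {ffun E -> bool}})
    (B : nat) :
  (forall t : {ffun E -> bool},
     #|[set s in S | [forall (j | j \notin E1), s j == t j]]| <= B)%N ->
  (#|S| * 2 ^ #|E1| <= 2 ^ #|E| * B)%N.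
Proof.
move=> fib; pose agree (s t : {ffun E -> bool}) := [forall (j | j \notin E1), s j == t j].
have -> : (2 ^ #|E| = #|{ffun E -> bool}|)%N by rewrite card_ffun card_bool.
rewrite -!sum_nat_const; apply: (@leq_trans (\sum_(s in S) \sum_(t | agree s t) 1)).
  apply: leq_sum => s _.
  pose flip (A : {set E}) := [ffun j => if j \in E1 then j \in A else s j].
  rewrite sum1dep_card -card_powerset -(card_in_imset (f := flip)).
    apply/subset_leq_card/fintype.subsetP => _ /imsetP [A _ ->]; rewrite inE.
    by apply/forall_inP => j jE1; rewrite ffunE (negbTE jE1).
  move=> A A'; rewrite !inE => /fintype.subsetP AE1 /fintype.subsetP A'E1 /ffunP eqAA'.
  apply/setP => j; have [jE1|jE1] := boolP (j \in E1).
    by have := eqAA' j; rewrite !ffunE jE1.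
  by apply/idP/idP => [/AE1|/A'E1] jin; rewrite jin in jE1.
rewrite (exchange_big_dep predT) //=; apply: leq_sum => t _.
by apply: leq_trans (fib t); rewrite -sum1dep_card.
Qed.

Lemma bin_simplex2 n : 'C(n + 2, n) = 'C(n.+2, 2).
Proof. by rewrite -bin_sub ?leq_addr // addKn addn2. Qed.

(** The binomials count ternary monomials, of degree [a + b + 1] on the left and of degrees [a] and
    [b] on the right; the product bounds from below the codimension of the space containing
    [f_1]. *)
Lemma bin2_simplex_add a b :
  ('C((a.+1 + b.+1).+1, 2) = 'C(a.+2, 2) + 'C(b.+2, 2) + a.+1 * b.+1)%N.
Proof.
elim: b => [|b IH]; first by rewrite addn1 [LHS]binS bin1 [in 'C(2, 2)]binn; lia.
by rewrite addnS [LHS]binS IH bin1 ['C(b.+3, 2)]binS bin1; lia.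
Qed.

Section PairCoeff.
Variables (K : fieldType) (m a b : nat) (G H : {mpoly K[m.+1]}) (k : multinom m.+1).

(** A coefficient of [f_1 = G_1 H_0 + G_0 H_1] as a linear function of the pair [(G_1, H_1)], with
    [G] and [H] standing for [G_0] and [H_0]. *)
Definition pair_coeff (w : dhomog m.+1 K a * dhomog m.+1 K b) : K^o :=
  mcoeff k (val w.1 * H + G * val w.2).

Lemma pair_coeff_linear : linear pair_coeff.
Proof.
move=> c u v; rewrite /pair_coeff /=.
by rewrite mulrDl mulrDr -scalerAl -scalerAr addrACA -scalerDr mcoeffD mcoeffZ.
Qed.
HB.instance Definition _ :=
  GRing.isLinear.Build K _ _ _ pair_coeff pair_coeff_linear.
End PairCoeff.

Lemma dim_pair_dhomog (K : fieldType) m a b :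
  dim (dhomog m.+1 K a * dhomog m.+1 K b)%type = ('C(a + m, a) + 'C(b + m, b))%N.
Proof. by []. Qed.

(** * Sign forms and their restrictions to three variables *)

Section Fiber.
Variables (K : numClosedFieldType) (r d : nat) (E : finType).
Variable (e : E -> multinom (3 + r.+1)).
Hypothesis e_inj : injective e.
Hypothesis mdeg_e : forall i, mdeg (e i) = d.
Hypothesis e_onto : forall k, mdeg k = d -> exists i, e i = k.

Definition sign_form (s : {ffun E -> bool}) : {mpoly K[3 + r.+1]} :=
  \sum_i bsign K (s i) *: mpolyX K (e i).

Let x3 : 'I_(3 + r.+1) := rshift 3 ord0.

(* The indices of the coefficients of [f_1], i.e. of the monomials
   [x_0^i x_1^j x_2^k x_3]. *)
Definition linear_part : {set E} :=
  [set i | (e i x3 == 1%N) && [forall j : 'I_r, e i (rshift 3 (lift ord0 j)) == 0%N]].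

Lemma mcoeff_sign_form s i : mcoeff (e i) (sign_form s) = bsign K (s i).
Proof.
rewrite raddf_sum (bigD1 i) //= mcoeffZ mcoeffX eqxx mulr1 big1 ?addr0 // => j ji.
by rewrite mcoeffZ mcoeffX (inj_eq e_inj) (negbTE ji) mulr0.
Qed.

Lemma dhomog_sign_form s : sign_form s \is homog d.
Proof. by apply: rpred_sum => i _; apply: rpredZ; rewrite dhomogX /= mdeg_e. Qed.

Lemma linear_partP i :
  reflect (exists2 k, mdeg k = d.-1
             & e i = mnm_add (extend_mnm r.+1 k) (mnm1 x3))
    (i \in linear_part).
Proof.
rewrite inE; apply: (iffP andP) => [[/eqP i1 /forallP i0]|[k _ ->]].
  pose k := Multinom [tuple e i (lshift r.+1 j) | j < 3].
  have eE : e i = mnm_add (extend_mnm r.+1 k) (mnm1 x3).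
    apply/mnmP => l; rewrite mnmDE mnm1E; case: (splitP l) => j lj.
      have -> : l = lshift r.+1 j by exact: val_inj.
      by rewrite extend_mnm_l mnmE -(inj_eq val_inj) /= gtn_eqF ?addn0 // ltn_addr.
    have -> : l = rshift 3 j by exact: val_inj.
    rewrite extend_mnm_r add0n /x3 (inj_eq (@rshift_inj _ _)).
    have [->|] := eqVneq j ord0; first by rewrite i1.
    rewrite eq_sym => j0.
    by have [j' -> _] := unlift_some j0; exact/eqP/i0.
  exists k => //; have := mdeg_e i; rewrite eE mdegD mdeg1 mdeg_extend_mnm addn1.
  by move=> <-.
split; first by rewrite mnmDE extend_mnm_r mnm1E eqxx.
by apply/forallP => j; rewrite mnmDE extend_mnm_r mnm1E
  (inj_eq (@rshift_inj _ _)) (negbTE (neq_lift _ _)).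
Qed.

Lemma card_linear_part : (0 < d)%N -> #|linear_part| = 'C(d.+1, 2).
Proof.
case: d linear_partP mdeg_e e_onto => // d' lpP deg_e onto _.
pose sb := [seq s2m t | t : d'.-tuple 'I_3 <- enum (mpoly.basis 3 d')].
have -> : 'C(d'.+2, 2) = size [seq mnm_add (extend_mnm r.+1 k) (mnm1 x3) | k <- sb].
  by rewrite size_map size_basis bin_simplex2.
rewrite cardE -(size_map e); apply/perm_size/uniq_perm.
- by rewrite map_inj_uniq ?enum_uniq.
- by rewrite map_inj_uniq ?uniq_basis // => k l /addIm/extend_mnm_inj.
move=> k; apply/mapP/mapP => [[i]|[l ls ->]].
  by rewrite mem_enum => /lpP [l dl ->] ->; exists l => //; rewrite -basis_cover dl.
have dl : mdeg l = d' by apply/eqP; rewrite basis_cover.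
have [|i ei] := onto (mnm_add (extend_mnm r.+1 l) (mnm1 x3)).
  by rewrite mdegD mdeg1 mdeg_extend_mnm dl addn1.
by exists i; rewrite // mem_enum; apply/lpP; exists l.
Qed.

Lemma restrict_sign_form_neq0 s : restrict_vars (sign_form s) != 0.
Proof.
(* The monomial [x_0 ^ d] survives the restriction, with coefficient 1 or -1. *)
pose k := mnm_muln (mnm1 (ord0 : 'I_3)) d.
have [|i ei] := @e_onto (extend_mnm r.+1 k).
  by rewrite mdeg_extend_mnm mdegMn mdeg1 mul1n.
apply/eqP => /(congr1 (mcoeff k)); rewrite mcoeff_restrict_vars -ei mcoeff_sign_form mcoeff0.
by case: (s i) => /eqP; rewrite ?oppr_eq0 oner_eq0.
Qed.

Lemma sign_form_neq0 s : sign_form s != 0.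
Proof.
by apply: contraNneq (restrict_sign_form_neq0 s) => ->; rewrite rmorph0.
Qed.

Lemma sign_form_nonunit s : (0 < d)%N -> sign_form s \isn't a GRing.unit.
Proof.
move=> d0; apply/negP => /andP [/eqP sC _].
have := mlead_deg (sign_form_neq0 s); rewrite [in RHS]sC msizeC.
rewrite (dhomog_coeff (dhomog_sign_form s)) ?mleadc_eq0 ?sign_form_neq0 //.
by case: (_ == _) => // -[dE]; rewrite dE in d0.
Qed.

(** The monomials of [linear_part] contain [x3] and are killed by the restriction, so [f_0] depends
    only on the other signs. *)
Lemma restrict_sign_form_agree (s t : {ffun E -> bool}) :
  (forall j, j \notin linear_part -> s j = t j) ->
  restrict_vars (sign_form s) = restrict_vars (sign_form t).
Proof.
move=> agree; apply/mpolyP => k; rewrite !mcoeff_restrict_vars !raddf_sum /=.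
apply: eq_bigr => i _; rewrite !mcoeffZ mcoeffX; case: eqP => [ei|]; last by rewrite !mulr0.
by rewrite agree // inE ei extend_mnm_r.
Qed.

(** The signs outside [linear_part] fix [f_0]. Its factor [G_0] has at most [d.+1 ^ a.+1] codes, and
    for each code [f_1] is the image of a vector in a space whose dimension is the sum of the two
    binomials. *)
Lemma card_reducible_agree a b (t : {ffun E -> bool}) (S : {set {ffun E -> bool}}) :
  (a.+1 + b.+1 = d)%N ->
  (forall s, s \in S -> forall j, j \notin linear_part -> s j = t j) ->
  (forall s, s \in S -> exists G H, [/\ G \is homog a.+1, H \is homog b.+1
     & sign_form s = G * H]) ->
  (#|S| <= d.+1 ^ a.+1 * 2 ^ ('C(a.+2, 2) + 'C(b.+2, 2)))%N.
Proof.
move=> abd agree fact.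
have /fin_all_exists [GH GHP] (s : {ffun E -> bool}) :
    exists GH : {mpoly K[3 + r.+1]} * {mpoly K[3 + r.+1]},
    s \in S -> [/\ GH.1 \is homog a.+1, GH.2 \is homog b.+1 & sign_form s = GH.1 * GH.2].
  have [/fact [G [H GHs]]|] := boolP (s \in S); last by exists (0, 0).
  by exists (G, H).
pose res := @restrict_vars K 3 r.+1; pose F := res (sign_form t).
(* The default 1 divides [F] and has degree 0, so the coding applies to every [s], also outside
   [S]. *)
pose G s := if s \in S then res (GH s).1 else 1.
have FE s : s \in S -> F = res (GH s).1 * res (GH s).2.
  move=> sS; have [_ _ sE] := GHP s sS.
  by rewrite /res -rmorphM -sE; apply/esym/restrict_sign_form_agree/agree.
have F0 : F != 0 by exact: restrict_sign_form_neq0.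
have [|s|s|code codeP] := @mpoly_divisor_code K 3 F d a.+1 _ G F0.
- by apply/msize_dhomog/dhomog_restrict_vars/dhomog_sign_form.
- rewrite /G; case: ifP => [sS|_]; last by exists F; rewrite mul1r.
  by exists (res (GH s).2); exact: FE.
- rewrite /G; case: ifP => [sS|_]; last by rewrite msize1.
  by have [hG _ _] := GHP s sS; apply/msize_dhomog/dhomog_restrict_vars.
rewrite (_ : d.+1 ^ a.+1 = #|{ffun 'I_a.+1 -> 'I_d.+1}|)%N; last by rewrite card_ffun !card_ord.
rewrite -[leqLHS]muln1; apply: (leq_card_fibers (code := code)) => k; rewrite muln1.
set Sk := [set s in S | _]; have [->|[s0]] := set_0Vmem Sk; first by rewrite cards0.
rewrite inE => /andP [s0S /eqP s0k].
have -> : ('C(a.+2, 2) + 'C(b.+2, 2) = dim (dhomog 3 K a * dhomog 3 K b)%type)%N.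
  by rewrite dim_pair_dhomog !bin_simplex2.
pose kk i := Multinom [tuple e i (lshift r.+1 j) | j < 3].
apply: (@card_sign_vectors_le K _ E linear_part
  (fun i => @pair_coeff K 2 a b (res (GH s0).1) (res (GH s0).2) (kk i)) t).
  by move=> s; rewrite inE => /andP [sS _]; exact: agree.
move=> s; rewrite inE => /andP [sS /eqP sk].
have [c c0] := codeP s0 s (etrans s0k (esym sk)); rewrite /G s0S sS => Gs.
have Hs : res (GH s).2 = c^-1 *: res (GH s0).2.
  have /mulfI : res (GH s).1 != 0.
    by apply: contraNneq F0 => G0; rewrite (FE s sS) G0 mul0r.
  by apply; rewrite -FE // (FE s0) // Gs -scalerAl -scalerAr scalerA divff // scale1r.
have [hG hH sE] := GHP s sS.
(* The scalars relating the factors of [s] to those of [s0] are moved to the derivatives, so that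
   the fixed pair of [s0] serves the whole fiber in the product rule. *)
have hu : c^-1 *: res (mderiv x3 (GH s).1) \is homog a.
  by apply/rpredZ/dhomog_restrict_vars/dhomog_mderiv.
have hv : c *: res (mderiv x3 (GH s).2) \is homog b.
  by apply/rpredZ/dhomog_restrict_vars/dhomog_mderiv.
exists (DHomog hu, DHomog hv) => i /linear_partP [l dl ei].
have kki : kk i = l.
  apply/mnmP => j; rewrite mnmE ei mnmDE extend_mnm_l mnm1E -(inj_eq val_inj) /=.
  by rewrite gtn_eqF ?addn0 // ltn_addr.
rewrite -mcoeff_sign_form ei /= kki /pair_coeff /=.
rewrite -scalerAl scalerAr -Hs -scalerAr scalerAl -Gs.
(* The monomial has exponent 1 in [x3], so differentiation leaves its coefficient unchanged. *)
rewrite /res -!rmorphM -rmorphD -mderivM -sE mcoeff_restrict_vars mcoeff_mderiv.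
by rewrite extend_mnm_r.
Qed.

(** The forms are sorted by the smaller degree [k + 1] of the two factors, with at most [d] values
    of [k]; each class contributes at most the fraction [d.+1 / 2 ^ (d.-1 %/ 3).+1]. *)
Lemma card_reducible (S : {set {ffun E -> bool}}) :
  (5 <= d)%N ->
  (forall s, s \in S -> exists g h, [/\ g \isn't a GRing.unit,
     h \isn't a GRing.unit & sign_form s = g * h]) ->
  (#|S| * 2 ^ (d.-1 %/ 3).+1 <= 2 ^ #|E| * (d * d.+1))%N.
Proof.
move=> d5 red.
have /fin_all_exists [deg degP] (s : {ffun E -> bool}) : exists k : 'I_d, s \in S ->
    exists b G H, [/\ (k.+1 + b.+1 = d)%N, (k <= b)%N,
      G \is homog k.+1, H \is homog b.+1 & sign_form s = G * H].
  have [/red [g [h [Ug Uh sE]]]|_] := boolP (s \in S); last first.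
    by exists (Ordinal (leq_trans (isT : 0 < 5)%N d5)).
  have [a [b [G [H [abd hG hH GH]]]]] :=
    dhomog_factors (dhomog_sign_form s) (sign_form_neq0 s) sE Ug Uh.
  have [ad bd] : (a < d)%N /\ (b < d)%N by lia.
  have [ab|/ltnW ba] := leqP a b.
    by exists (Ordinal ad) => _; exists b, G, H.
  by exists (Ordinal bd) => _; exists a, H, G; rewrite addnC mulrC.
rewrite mulnCA -[X in (_ <= X * _)%N](card_ord d).
apply: (leq_card_fibers (code := deg)) => k.
set Sk := [set s in S | _]; have [->|[s0]] := set_0Vmem Sk; first by rewrite cards0.
rewrite inE => /andP [/degP [b [_ [_ [kbd kb _ _ _]]]] /eqP s0k].
rewrite s0k in kbd kb; pose D := ('C(k.+2, 2) + 'C(b.+2, 2))%N.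
have cardSk : (#|Sk| * 2 ^ #|linear_part| <= 2 ^ #|E| * (d.+1 ^ k.+1 * 2 ^ D))%N.
  apply: leq_card_agree => t; apply: (card_reducible_agree (t := t) kbd) => s.
    by rewrite inE => /andP [_ /forall_inP agr] j /agr /eqP.
  rewrite !inE => /andP [/andP [/degP [b' [G [H [kbd' _ hG hH sE]]]] /eqP sk] _].
  rewrite sk in kbd' hG; exists G, H; split => //.
  by have -> : b = b' by lia.
have cardE : #|linear_part| = (D + k.+1 * b.+1)%N.
  by rewrite card_linear_part -?bin2_simplex_add ?kbd //; lia.
(* From [k <= b] and [5 <= d] come [d <= 2 (b + 1)] and [3 <= b + 1]; moreover [2 c + 1 <= 2 ^ c]
   for [3 <= c]. *)
have d_le : (d.+1 <= 2 ^ b.+1)%N.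
  have : (3 <= b.+1)%N by lia.
  have : (d.+1 <= (2 * b.+1).+1)%N by lia.
  move=> /leq_trans le b3; apply: le.
  elim: {kbd kb D cardSk cardE} b b3 => // c IH; rewrite leq_eqVlt => /orP [/eqP [<-] //|c3].
  by have := IH c3; rewrite [(2 ^ c.+2)%N]expnS; move: (2 ^ c.+1)%N => N; lia.
(* Of the [k + 1] factors [d.+1 / 2 ^ b.+1], all but one are bounded by 1. *)
have : (#|Sk| * 2 ^ b.+1 <= 2 ^ #|E| * d.+1)%N.
  have pos : (0 < 2 ^ (D + k * b.+1))%N by rewrite expn_gt0.
  rewrite -(leq_pmul2r pos) -mulnA -expnD.
  have -> : (b.+1 + (D + k * b.+1) = #|linear_part|)%N by rewrite cardE mulSn; lia.
  apply: leq_trans cardSk _; rewrite -!mulnA leq_mul // expnS -mulnA leq_mul //.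
  rewrite expnD mulnC leq_mul // [(k * _)%N]mulnC expnM.
  by case: (nat_of_ord k) => // k'; rewrite leq_exp2r.
(* Since [b + 1] is at least [d / 2], it is at least the exponent [(d - 1) / 3 + 1]. *)
apply: leq_trans; rewrite leq_mul2l leq_exp2l //; apply/orP; right.
lia.
Qed.
End Fiber.

(** * Random signs *)

Section SignVectors.
Context (disp : measure_display) (T : measurableType disp) (R : realType).
Variables (P : probability T R) (E : finType) (X : E -> {RV P >-> int}).

Let outcome (c : E -> int) : set T := [set w | forall a, X a w = c a].

Lemma measurable_outcome c : measurable (outcome c).
Proof.
rewrite (_ : outcome c = \bigcap_(a in [set: E]) (X a @^-1` [set c a])).
  apply: fin_bigcap_measurable => // a _; exact: measurable_funPTI.
by apply/seteqP; split=> [w h a _|w h a]; [exact: h|exact: (h a I)].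
Qed.

(** The tuple of values lies in a countable type, so the event is a countable union of outcomes. *)
Lemma measurable_outcomes (Q : (E -> int) -> Prop) :
  measurable [set w | Q (fun a => X a w)].
Proof.
rewrite (_ : [set _ | _] =
    \bigcup_(c : {ffun E -> int}) [set w | outcome c w /\ Q c]); last first.
  apply/seteqP; split=> [w Qw|w [c _ [wc Qc]]] /=.
    exists [ffun a => X a w] => //; split=> [a|]; first by rewrite ffunE.
    have -> // : [ffun a => X a w] = (fun a => X a w) :> (E -> int).
    by apply/funext => a; rewrite ffunE.
  by have -> : (fun a => X a w) = c by apply/funext.
apply: countable_bigcupT_measurable => [|c]; first exact: countableP.
have [Qc|nQc] := pselect (Q c).
  rewrite (_ : [set _ | _] = outcome c); first exact: measurable_outcome.
  by apply/seteqP; split=> w // [].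
by rewrite (_ : [set _ | _] = set0) //; apply/seteqP; split=> w // [].
Qed.

Lemma probability_outcome (s : {ffun E -> bool}) :
  independent_RV P X -> (forall a, rademacher P (X a)) ->
  P (outcome (fun a => bsign int (s a))) = ((2 ^+ #|E|)^-1)%:E.
Proof.
move=> indep rad.
have := indep [set: E]%SET (fun a => [set bsign int (s a)]) (fun _ _ => I).
rewrite (_ : [set _ | _] = outcome (fun a => bsign int (s a))) => [->|]; last first.
  by apply/seteqP; split=> w h a; [exact: h|move=> _; exact: h].
rewrite -exprVn -cardsT -prodr_const -prodEFin.
by apply: eq_bigr => a _; have [p1 pN1] := rad a; case: (s a).
Qed.

(** The variables may leave 1 and -1 on a null set, so the complement is bounded from below instead,
    by the disjoint outcomes outside [S], each of probability [2 ^- #|E|]. *)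
Lemma probability_signs_le (Q : (E -> int) -> Prop) (S : {set {ffun E -> bool}}) :
  independent_RV P X -> (forall a, rademacher P (X a)) ->
  (forall s : {ffun E -> bool}, s \notin S -> ~ Q (fun a => bsign int (s a))) ->
  (P [set w | Q (fun a => X a w)] <= (#|S|%:R / 2 ^+ #|E|)%:E)%E.
Proof.
move=> indep rad notQ; set A := [set w | _].
have mA : measurable A := measurable_outcomes Q.
pose F (s : {ffun E -> bool}) := outcome (fun a => bsign int (s a)).
have mF s : measurable (F s) by exact: measurable_outcome.
pose D := [set` (~: S)%SET].
have finD : finite_set D by exact: finite_finset.
have FA : \bigcup_(s in D) F s `<=` ~` A.
  move=> w [s]; rewrite /D /= finset.in_setC => sS Fw; rewrite /A /= => Qw; apply: (notQ s sS).
  by have <- : (fun a => X a w) = (fun a => bsign int (s a)) by apply/funext.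
have PF : P (\bigcup_(s in D) F s) = (#|~: S|%:R / 2 ^+ #|E|)%:E.
  rewrite measure_fin_bigcup //; last first.
    move=> s t _ _ [w [Fs Ft]]; apply/ffunP => a; apply: (@bsign_inj int).
    by rewrite -Fs -Ft.
  rewrite -(@bigfs _ _ _ _ (index_enum _)) ?index_enum_uniq //; last first.
    by move=> s _; rewrite mem_index_enum.
  rewrite (eq_bigr _ (fun s _ => probability_outcome s indep rad)).
  by rewrite sumEFin sumr_const mulr_natl.
have : (P (\bigcup_(s in D) F s) <= P (~` A))%E.
  apply: le_measure => //; rewrite inE; last exact: measurableC.
  exact: fin_bigcup_measurable.
rewrite PF probability_setC //.
have : P A \is a fin_num by exact: fin_num_measure.
case: (P A) => // p _; rewrite -EFinB !lee_fin.
have two_gt0 : 0 < 2 ^+ #|E| :> R by rewrite exprn_gt0.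
have cardSC : #|S|%:R + #|~: S|%:R = 2 ^+ #|E| :> R.
  by rewrite -natrD cardsC card_ffun card_bool natrX.
have : #|S|%:R / 2 ^+ #|E| + #|~: S|%:R / 2 ^+ #|E| = 1 :> R.
  by rewrite -mulrDl cardSC divff // gt_eqF.
by lra.
Qed.
End SignVectors.

Theorem corollary1p4 (R : realType) (disp : measure_display)
    (T : measurableType disp) (P : probability T R) (n d : nat)
    (eps : exponent n d -> {RV P >-> int}) :
  (3 <= n)%N -> (3 <= d)%N ->
  independent_RV P eps ->
  (forall a, rademacher P (eps a)) ->
  (P [set w | ~ absolutely_irreducible
                  (form_of_coeffs (fun a => eps a w))] <=
     ((n * (n + 1) * d ^ (n - 1))%:R / 2 ^+ ((d - 1) %/ 3 + 1))%:E)%E.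
Proof.
case: n eps => [|[|[|r]]] // eps _ d3 indep rad.
pose Q c := ~ absolutely_irreducible (@form_of_coeffs r.+3 d c).
pose B := (r.+3 * (r.+3 + 1) * d ^ (r.+3 - 1))%N.
(* Since [n] is at least 3, [n (n + 1)] is at least 12 and [n - 1] at least 2. This settles [d <= 4]
   and dominates [d (d + 1)] for larger [d]. *)
have dd_le_B : (12 * d ^ 2 <= B)%N.
  rewrite /B; apply: leq_mul; first nia.
  by rewrite leq_pexp2l //; lia.
have [d5|d4] := leqP 5 d; last first.
  have /le_trans : (P [set w | Q (fun a => eps a w)] <= 1)%E.
    by apply: probability_le1; exact: measurable_outcomes.
  apply; rewrite lee_fin ler_pdivlMr ?exprn_gt0 // mul1r -natrX ler_nat.
  apply: leq_trans dd_le_B.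
  by have [->|->] : d = 3 \/ d = 4 by lia.
(* With [n = r + 3] there are [3 + r.+1] variables; [e] forgets the degree bound that makes the
   exponent type finite. *)
pose e (a : exponent r.+3 d) : mpoly.multinom (3 + r.+1) := val (val a).
have e_inj : injective e by move=> a b /val_inj/val_inj.
have mdeg_e a : mdeg (e a) = d by apply/eqP; exact: (valP a).
have e_onto (k : mpoly.multinom (3 + r.+1)) : mdeg k = d -> exists a, e a = k.
  move=> kd; have kd1 : (mdeg k < d.+1)%N by rewrite kd.
  have kd2 : mdeg (mpoly.BMultinom kd1) == d by exact/eqP.
  by exists (Sub (mpoly.BMultinom kd1) kd2).
pose sf (s : {ffun exponent r.+3 d -> bool}) : {mpoly algC[3 + r.+1]} := sign_form algC e s.
have sfE (s : {ffun exponent r.+3 d -> bool}) :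
    map_mpoly (ratr : rat -> algC) (form_of_coeffs (fun a => bsign int (s a))) = sf s.
  rewrite /form_of_coeffs raddf_sum; apply: eq_bigr => a _.
  rewrite /= map_mpolyZ map_mpolyX rmorph_int.
  by case: (s a); rewrite /= ?rmorphN1.
pose S := [set s : {ffun exponent r.+3 d -> bool} | `[< Q (fun a => bsign int (s a)) >]]%SET.
have cardS : (#|S| * 2 ^ (d.-1 %/ 3).+1 <= 2 ^ #|exponent r.+3 d| * (d * d.+1))%N.
  apply: (@card_reducible algC r d _ e e_inj mdeg_e e_onto S d5) => s.
  rewrite finset.inE => /asboolP; rewrite /Q /absolutely_irreducible sfE => red.
  apply: contrapT => irr; apply: red; split.
  - exact: (sign_form_neq0 algC e_inj e_onto).
  - by apply: (sign_form_nonunit algC e_inj mdeg_e e_onto); lia.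
  move=> g h gh; apply: contrapT => /not_orP [/negP Ug /negP Uh].
  by apply: irr; exists g, h.
have := @probability_signs_le _ _ _ P _ eps Q S indep rad.
move=> /(_ _)/le_trans; apply => [s|].
  by rewrite finset.inE => /asboolPn.
rewrite lee_fin ler_pdivrMr ?exprn_gt0 // mulrAC ler_pdivlMr ?exprn_gt0 //.
rewrite -!natrX -!natrM ler_nat subn1 addn1.
apply: leq_trans cardS _; rewrite mulnC leq_mul2r; apply/orP; right.
by apply: leq_trans dd_le_B; nia.
Qed.
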